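(* Let $k$ be a field, let $A$ be a finite dimensional $k$-algebra, and let $\alpha\in\mathrm{Hom}_k(A\otimes A,A^* )$ be a Hochschild 2-cocycle. Then the following three statements are equivalent: (1) The Hochschild extension $T(A,\alpha)$ is a symmetric algebra. (2) There exist $c\in Z(A)\cap U(A)$ and $h\in A^*$ such that $$\alpha(a\otimes b)(c)-\alpha(b\otimes a)(c)+h(ab-ba)=0$$ for all $a,b\in A$. (3) There exists $c\in Z(A)\cap U(A)$ such that the Hochschild cohomology class $[i_c^*(\widetilde{\alpha})]\in H^2(C_\bullet(A)^* )\cong HH_2(A)^*\cong HH^2(A,A^* )$ can be lifted to a cyclic cohomology class in $HC^2(A)\cong HC_2(A)^*$ along the canonical map $I^2: HC^2(A)\to H^2(C_\bullet(A)^* )$ in the Connes periodicity exact sequence; that is, $[i_c^*(\widetilde{\alpha})]$ lies in the image of $I^2$.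
   Context: Conventions. $k$ is a fixed field, $\otimes=\otimes_k$, $(-)^*=\mathrm{Hom}_k(-,k)$ (and for a linear map $u$, $u^*$ denotes its $k$-dual, $u^*(f)=f\circ u$). Algebras are unital and associative. $Z(A)$ is the center of $A$ and $U(A)$ is the group of units (invertible elements) of $A$. The dual $A^*$ is an $A$-bimodule via $(cfa)(b):=f(abc)$ for $f\in A^*$ and $a,b,c\in A$. Hochschild 2-cocycle. A $k$-linear map $\alpha:A\otimes A\to A^*$ is a Hochschild 2-cocycle if $$a\,\alpha(b\otimes c)-\alpha(ab\otimes c)+\alpha(a\otimes bc)-\alpha(a\otimes b)\,c=0\quad\text{for all }a,b,c\in A.$$ Hochschild extension. $T(A,\alpha)$ is the $k$-algebra with underlying vector space $A\oplus A^*$ and multiplication $(a,f)(b,g):=(ab,\;ag+fb+\alpha(a\otimes b))$. Symmetric algebra. A finite dimensional $k$-algebra $T$ is symmetric if $T\cong T^*$ as $T$-bimodules. Hochschild complex. $C_\bullet(A)$ is the chain complex with $A^{\otimes n+1}$ in degree $n\ge 0$ and differential $b_n:A^{\otimes n+1}\to A^{\otimes n}$, $$b_n(a_0\otimes\cdots\otimes a_n)=\sum_{i=0}^{n-1}(-1)^i a_0\otimes\cdots\otimes a_ia_{i+1}\otimes\cdots\otimes a_n+(-1)^n a_na_0\otimes a_1\otimes\cdots\otimes a_{n-1}.$$ $HH_n(A)$ is its $n$-th homology. The dual cochain complex $C_\bullet(A)^*=((A^{\otimes\bullet+1})^*,b_\bullet^* )$ has cohomology $H^n(C_\bullet(A)^*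 )\cong HH_n(A)^*\cong HH^n(A,A^* )$, where $HH^n(A,A^* )$ is the Hochschild cohomology of $A$ with coefficients in the bimodule $A^*$. The adjoint $\widetilde{\alpha}$. For $\alpha\in\mathrm{Hom}_k(A\otimes A,A^* )$, $\widetilde{\alpha}\in(A^{\otimes 3})^*$ is given by $\widetilde{\alpha}(a\otimes b\otimes c):=\alpha(b\otimes c)(a)$. If $\alpha$ is a Hochschild 2-cocycle, then $b_3^*(\widetilde{\alpha})=0$. Contraction. For $c\in Z(A)$, $i_c:C_\bullet(A)\to C_\bullet(A)$ is the chain map $i_c(a_0\otimes a_1\otimes\cdots\otimes a_n):=a_0c\otimes a_1\otimes\cdots\otimes a_n$. Thus $i_c^*(\widetilde{\alpha})=\widetilde{\alpha}\circ i_c\in(A^{\otimes 3})^*$ is a 2-cocycle of $C_\bullet(A)^*$, with class $[i_c^*(\widetilde{\alpha})]$. Cyclic cohomology. The Connes boundary operator $B_n:A^{\otimes n+1}\to A^{\otimes n+2}$ is $$B_n(a_0\otimes\cdots\otimes a_n)=\sum_{i=0}^n(-1)^{ni}\big(1\otimes a_i\otimes\cdots\otimes a_n\otimes a_0\otimes\cdots\otimes a_{i-1}+a_i\otimes 1\otimes a_{i+1}\otimes\cdots\otimes a_n\otimes a_0\otimes\cdots\otimes a_{i-1}\big).$$ The cyclic bicomplex of $A$ has columns indexed by $j\ge 0$, column $j$ being $C_\bullet(A)$ shifted so that $A^{\otimes n-2j+1}$ lies in total degree $n$, with vertical differentials $b$ and horizontal differentials $B$ (from column $j$ to column $j-1$);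 $HC_n(A)$ is the $n$-th homology of its total complex. Dually, $HC^n(A)$ is the $n$-th cohomology of the total complex of the $k$-dual cyclic cochain bicomplex: its degree $n$ part is $\bigoplus_{j\ge 0,\,2j\le n}(A^{\otimes n-2j+1})^*$, with coboundary $(f_0,f_1,f_2,\dots)\mapsto(b^*f_0,\;B^*f_0+b^*f_1,\;B^*f_1+b^*f_2,\dots)$. One has $HC^n(A)\cong HC_n(A)^*$. In particular, a cyclic 2-cocycle is a pair $(\beta,\gamma)\in(A^{\otimes 3})^*\oplus A^*$ with $b_3^*(\beta)=0$ and $B_1^*(\beta)+b_1^*(\gamma)=0$, and the 2-coboundaries are the pairs $(b_2^*(\eta),B_0^*(\eta))$ with $\eta\in(A^{\otimes 2})^*$. The map $I^2$. $I^n:HC^n(A)\to H^n(C_\bullet(A)^* )$ is the map of the Connes periodicity exact sequence induced by projecting the cyclic cochain bicomplex onto its first column ($j=0$); in particular $I^2([(\beta,\gamma)])=[\beta]$. *)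

(* Defs.v *)
From HB Require Import structures.
From mathcomp Require Import all_boot all_algebra all_field.
From mathcomp Require Import generic_quotient ring_quotient.
From mathcomp Require Import boolp functions.
From mathcomp Require Import zify ring.

Set Implicit Arguments.
Unset Strict Implicit.
Unset Printing Implicit Defensive.

Import GRing.Theory.
Local Open Scope ring_scope.
Local Open Scope quotient_scope.

Section Dual.
Variables (k : fieldType) (A : falgType k).
Implicit Types (a b c x : A) (f : 'Hom(A, k^o)).

(* The bimodule structure of the dual: (c f a)(b) = f (a b c). *)
Definition lact c f : 'Hom(A, k^o) := (f \o amulr c)%VF.
Definition ract f a : 'Hom(A, k^o) := (f \o amull a)%VF.

Lemma lactE c f b : lact c f b = f (b * c).
Proof. by rewrite /lact comp_lfunE lfunE. Qed.

Lemma ractE f a b : ract f a b = f (a * b).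
Proof. by rewrite /ract comp_lfunE lfunE. Qed.

(* A is isomorphic to its dual as an A-bimodule. *)
Definition symmetric_algebra : Prop :=
  exists phi : 'Hom(A, 'Hom(A, k^o)),
    [/\ bijective phi,
        forall a x, phi (a * x) = lact a (phi x)
      & forall x a, phi (x * a) = ract (phi x) a].

End Dual.

Section HochschildExtension.
Variables (k : fieldType) (A : falgType k).

(* Linear maps out of A (x) A are given as bilinear maps. *)
Definition hochschild_2cocycle (alpha : {bilinear A -> A -> 'Hom(A, k^o)}) :=
  forall a b c : A,
    lact a (alpha b c) - alpha (a * b) c + alpha a (b * c)
      - ract (alpha a b) c = 0.

(* T(A, alpha). The product is associative and unital because of the cocycle  *)
(* condition, which is therefore an argument of the type.                     *)
Definition hext (alpha : {bilinear A -> A -> 'Hom(A, k^o)})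
  (alphaP : hochschild_2cocycle alpha) : Type := (A * 'Hom(A, k^o))%type.

Variables (alpha : {bilinear A -> A -> 'Hom(A, k^o)})
          (alphaP : hochschild_2cocycle alpha).

HB.instance Definition _ := Vector.copy (hext alphaP) (A * 'Hom(A, k^o))%type.

Definition hext_mul (u v : hext alphaP) : hext alphaP :=
  (u.1 * v.1, lact u.1 v.2 + ract u.2 v.1 + alpha u.1 v.1).

(* alpha need not be normalized, whence the second component. *)
Definition hext_one : hext alphaP := (1, - alpha 1 1).

Lemma cocycleE (a b c x : A) :
  alpha b c (x * a) - alpha (a * b) c x + alpha a (b * c) x
    - alpha a b (c * x) = 0.
Proof.
have /lfunP/(_ x) := alphaP a b c.
by rewrite !(add_lfunE, opp_lfunE, zero_lfunE) lactE ractE.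
Qed.

Fact hext_mulA : associative hext_mul.
Proof.
move=> [a f] [b g] [c h]; congr pair; rewrite /= ?mulrA //.
apply/lfunP=> x.
rewrite !(add_lfunE, lactE, ractE) /=.
have := cocycleE a b c x; rewrite !mulrA.
move: (alpha b c _) (alpha (a * b) c x) (alpha a (b * c) x) (alpha a b _).
move: (h _) (g _) (f _); rewrite /GRing.regular => u v w p q r s H.
by apply/eqP; rewrite -subr_eq0 -H; apply/eqP; ring.
Qed.

Fact hext_mul1 : left_id hext_one hext_mul.
Proof.
move=> [b g]; congr pair; rewrite /= ?mul1r //.
apply/lfunP=> x.
rewrite !(add_lfunE, lactE, ractE, opp_lfunE) mulr1.
have := cocycleE 1 1 b x; rewrite !(mul1r, mulr1) subrr add0r => /eqP.
by rewrite subr_eq0 => /eqP ->; rewrite addrNK.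
Qed.

Fact hext_mulr1 : right_id hext_one hext_mul.
Proof.
move=> [b g]; congr pair; rewrite /= ?mulr1 //.
apply/lfunP=> x.
rewrite !(add_lfunE, lactE, ractE, opp_lfunE) mul1r.
have := cocycleE b 1 1 x; rewrite !(mul1r, mulr1) addrNK => /eqP.
by rewrite subr_eq0 => /eqP ->; rewrite addrAC addNr add0r.
Qed.

Fact hext_mulDl : left_distributive hext_mul +%R.
Proof.
move=> [a f] [b g] [c h]; congr pair; rewrite /= ?mulrDl //.
apply/lfunP=> x; rewrite linearDl.
rewrite !(add_lfunE, lactE, ractE) /= ?(add_lfunE, lactE, ractE) mulrDr linearD.
by rewrite /=; ring.
Qed.

Fact hext_mulDr : right_distributive hext_mul +%R.
Proof.
move=> [a f] [b g] [c h]; congr pair; rewrite /= ?mulrDr //.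
apply/lfunP=> x; rewrite linearDr.
rewrite !(add_lfunE, lactE, ractE) /= ?(add_lfunE, lactE, ractE) mulrDl linearD.
by rewrite /=; ring.
Qed.

Fact hext_one_neq0 : hext_one != 0.
Proof. by apply/eqP=> -[] /eqP; rewrite oner_eq0. Qed.

HB.instance Definition _ := GRing.Zmodule_isNzRing.Build (hext alphaP)
  hext_mulA hext_mul1 hext_mulr1 hext_mulDl hext_mulDr hext_one_neq0.

Fact hext_scalerAl (s : k) (u v : hext alphaP) : s *: (u * v) = (s *: u) * v.
Proof.
case: u v => [a f] [b g]; congr pair; rewrite /= ?scalerAl //.
apply/lfunP=> x; rewrite linearZl_LR.
rewrite !(scale_lfunE, add_lfunE, lactE, ractE) /= -scalerAr linearZ /=.
by rewrite !scalerDr.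
Qed.

HB.instance Definition _ :=
  GRing.Lmodule_isLalgebra.Build k (hext alphaP) hext_scalerAl.

Fact hext_scalerAr (s : k) (u v : hext alphaP) : s *: (u * v) = u * (s *: v).
Proof.
case: u v => [a f] [b g]; congr pair; rewrite /= ?scalerAr //.
apply/lfunP=> x; rewrite linearZr_LR.
rewrite !(scale_lfunE, add_lfunE, lactE, ractE) /= -scalerAl linearZ /=.
by rewrite !scalerDr.
Qed.

HB.instance Definition _ :=
  GRing.Lalgebra_isAlgebra.Build k (hext alphaP) hext_scalerAr.

HB.instance Definition _ := Algebra_isFalgebra.Build k (hext alphaP).

Lemma hext_mulE (u v : hext alphaP) :
  u * v = (u.1 * v.1, lact u.1 v.2 + ract u.2 v.1 + alpha u.1 v.1).
Proof. by []. Qed.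

End HochschildExtension.

Section Cohomology.
Variables (k : fieldType) (C : nat -> lmodType k).
Variable d : forall n, {linear C n -> C n.+1}.

Definition is_coboundary n : C n -> Prop :=
  match n with
  | 0 => fun z => z = 0
  | m.+1 => fun z => exists y : C m, z = d m y
  end.

Variable n : nat.

Definition cocycle_pred : {pred C n} := fun z => d n z == 0.

Fact cocycle_pred_closed : zmod_closed cocycle_pred.
Proof.
split=> [|x y]; rewrite !unfold_in; first by rewrite linear0.
by move=> /eqP dx /eqP dy; rewrite linearB dx dy subrr.
Qed.
HB.instance Definition _ := GRing.isZmodClosed.Build (C n) cocycle_pred
  cocycle_pred_closed.

Record cocycle := Cocycle { cocycle_val : C n; _ : cocycle_val \in cocycle_pred }.

HB.instance Definition _ := [isSub for cocycle_val].
HB.instance Definition _ := [Choice of cocycle by <:].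
HB.instance Definition _ := [SubChoice_isSubZmodule of cocycle by <:].

Lemma cocycle_eq0 (z : cocycle) : d n (cocycle_val z) = 0.
Proof. by apply/eqP; case: z. Qed.

Definition cobound_pred : {pred cocycle} :=
  fun z => `[< is_coboundary (cocycle_val z) >].

Lemma is_coboundary0 : is_coboundary (0 : C n).
Proof. by case: (n) => [|m] //=; exists 0; rewrite linear0. Qed.

Lemma is_coboundaryB (x y : C n) :
  is_coboundary x -> is_coboundary y -> is_coboundary (x - y).
Proof.
case: (n) x y => [|m] x y /=; first by move=> -> ->; rewrite subr0.
by move=> [u ->] [v ->]; exists (u - v); rewrite linearB.
Qed.

Fact cobound_pred_closed : zmod_closed cobound_pred.
Proof.
split=> [|x y]; rewrite !unfold_in; first exact/asboolP/is_coboundary0.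
by move=> /asboolP cx /asboolP cy; apply/asboolP/is_coboundaryB.
Qed.
HB.instance Definition _ := GRing.isZmodClosed.Build cocycle cobound_pred
  cobound_pred_closed.

(* Cocycles modulo those cocycles that are coboundaries, as an abelian group. *)
Definition cohomology : zmodType := Quotient.quot cobound_pred.

Definition cohomology_class (z : C n) (dz : d n z = 0) : cohomology :=
  \pi_cohomology (Cocycle (introT eqP dz)).

Lemma cohomology_classP (z z' : cocycle) :
  reflect (is_coboundary (cocycle_val z - cocycle_val z'))
    (\pi_cohomology z == \pi_cohomology z').
Proof. by rewrite -Quotient.idealrBE; apply: asboolP. Qed.

End Cohomology.

Section MultilinearForms.
Variables (k : fieldType) (A : falgType k).

Definition multilinear p (f : ('I_p -> A) -> k^o) : Prop :=
  forall (a : 'I_p -> A) (i : 'I_p) (s : k) (x y : A),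
    f [eta a with i |-> s *: x + y]
      = s *: f [eta a with i |-> x] + f [eta a with i |-> y].

(* Precomposition with a map that is linear in each slot preserves            *)
(* multilinearity.                                                            *)
Definition slotwise p q (D : ('I_p -> A) -> ('I_q -> A)) :=
  forall (a : 'I_p -> A) (l : 'I_p), exists (l' : 'I_q) (g : A -> A),
    (forall (s : k) x y, g (s *: x + y) = s *: g x + g y)
    /\ forall x, D [eta a with l |-> x] = [eta D a with l' |-> g x].

Lemma slotwise_multilinear p q (D : ('I_p -> A) -> ('I_q -> A)) f :
  slotwise D -> multilinear f -> multilinear (f \o D).
Proof.
move=> sD mf a l s x y; have [l' [g [lg Dg]]] := sD a l.
by rewrite /comp !Dg lg mf.
Qed.

Definition multilinear_pred p : {pred ('I_p -> A) -> k^o} :=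
  fun f => `[< multilinear f >].

Fact multilinear_closed p : subsemimod_closed (@multilinear_pred p).
Proof.
split=> [|s f]; rewrite ?unfold_in; last first.
  move=> /asboolP mf; apply/asboolP=> a i t x y.
  by rewrite -[LHS]/(s *: f _) mf scalerDr !scalerA mulrC.
split=> [|f g]; rewrite !unfold_in.
  by apply/asboolP=> a i s x y; rewrite -[LHS]/(0 : k^o) [RHS]addr0 scaler0.
move=> /asboolP mf /asboolP mg; apply/asboolP=> a i s x y.
by rewrite -[LHS]/(f _ + g _) mf mg [LHS]addrACA -scalerDr.
Qed.
HB.instance Definition _ p := GRing.isSubmodClosed.Build k
  (('I_p -> A) -> k^o) (@multilinear_pred p) (@multilinear_closed p).

(* The dual of the (n+1)-fold tensor power of A, i.e. the degree n part of    *)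
(* the dual Hochschild complex, by the universal property of tensor products: *)
(* f a stands for f (a_0 (x) ... (x) a_n).                                    *)
Record cochain n := Cochain {
  cochain_val :> ('I_n.+1 -> A) -> k^o;
  _ : cochain_val \in @multilinear_pred n.+1 }.

HB.instance Definition _ n := [isSub of cochain n for @cochain_val n].
HB.instance Definition _ n := [Choice of cochain n by <:].
HB.instance Definition _ n := [SubChoice_isSubLmodule of cochain n by <:].

Lemma cochain_multilinear n (f : cochain n) : multilinear f.
Proof. by apply/asboolP; case: f. Qed.

Lemma cochainP n (f g : cochain n) : (forall a, f a = g a) -> f = g.
Proof. by move=> fg; apply/val_inj/funext. Qed.

Definition mk_cochain n F (mF : multilinear F) : cochain n :=
  Cochain (introT (asboolP _) mF).

(* a_0, ..., a_i a_(i+1), ..., a_n.+1 *)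
Definition face n (i : nat) (a : 'I_n.+2 -> A) : 'I_n.+1 -> A := fun j =>
  if (j < i)%N then a (inord j)
  else if j == i :> nat then a (inord j) * a (inord j.+1)
  else a (inord j.+1).

(* a_(n+1) a_0, a_1, ..., a_n *)
Definition last_face n (a : 'I_n.+2 -> A) : 'I_n.+1 -> A := fun j =>
  if j == 0%N :> nat then a ord_max * a ord0 else a (inord j).

(* 1, a_i, ..., a_n, a_0, ..., a_(i-1) *)
Definition rot_one n (i : nat) (a : 'I_n.+1 -> A) : 'I_n.+2 -> A := fun j =>
  if j == 0%N :> nat then 1 else a (inord ((i + j.-1) %% n.+1)%N).

(* a_i, 1, a_(i+1), ..., a_n, a_0, ..., a_(i-1) *)
Definition rot_one2 n (i : nat) (a : 'I_n.+1 -> A) : 'I_n.+2 -> A := fun j =>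
  if j == 0%N :> nat then a (inord i)
  else if j == 1%N :> nat then 1 else a (inord ((i + j.-1) %% n.+1)%N).

(* a_0 c, a_1, ..., a_n *)
Definition mul_head n (c : A) (a : 'I_n.+1 -> A) : 'I_n.+1 -> A := fun j =>
  if j == 0%N :> nat then a j * c else a j.

Lemma inord_eqE n (j : nat) (l : 'I_n.+1) : (j <= n)%N -> (inord j == l) = (j == l).
Proof. by move=> jn; rewrite -val_eqE /= inordK. Qed.

Lemma linear_lmul (c : A) (s : k) (x y : A) :
  c * (s *: x + y) = s *: (c * x) + c * y.
Proof. by rewrite mulrDr scalerAr. Qed.

Lemma linear_rmul (c : A) (s : k) (x y : A) :
  (s *: x + y) * c = s *: (x * c) + y * c.
Proof. by rewrite mulrDl scalerAl. Qed.

Lemma slotwise_face n i : (i < n.+1)%N -> slotwise (@face n i).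
Proof.
move=> lt_in a l; have lt_l := ltn_ord l.
have [li | il | eil] := ltngtP l i.
- exists (inord l), id; split=> // x; apply/funext=> j; have lt_j := ltn_ord j.
  rewrite /face /= !inord_eqE ?[j == inord l]eq_sym ?inord_eqE; try lia.
  rewrite [l == j :> nat]eq_sym.
  by case: (ltngtP j i) => ji //; do ?(case: eqVneq => ? //; try lia).
- have [eil|nil] := eqVneq (l : nat) i.+1.
    exists (inord i), (fun x => a (inord i) * x); split=> [*|x].
      exact: linear_lmul.
    apply/funext=> j; have lt_j := ltn_ord j.
    rewrite /face /= !inord_eqE ?[j == inord i]eq_sym ?inord_eqE; try lia.
    rewrite [i == j :> nat]eq_sym.
    case: (ltngtP j i) => ji //; do ?(case: eqVneq => ? //; try lia).
    by rewrite ji.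
  exists (inord l.-1), id; split=> // x; apply/funext=> j.
  have lt_j := ltn_ord j.
  rewrite /face /= !inord_eqE ?[j == inord _]eq_sym ?inord_eqE; try lia.
  by case: (ltngtP j i) => ji //; do ?(case: eqVneq => ? //; try lia).
- exists (inord i), (fun x => x * a (inord i.+1)); split=> [*|x].
    exact: linear_rmul.
  apply/funext=> j; have lt_j := ltn_ord j.
  rewrite /face /= !inord_eqE ?[j == inord i]eq_sym ?inord_eqE; try lia.
  rewrite [i == j :> nat]eq_sym.
  case: (ltngtP j i) => ji //; do ?(case: eqVneq => ? //; try lia).
  by rewrite ji.
Qed.

Lemma slotwise_last_face n : slotwise (@last_face n).
Proof.
move=> a l; have lt_l := ltn_ord l.
have [l0 | l_gt0] := posnP l.
  exists ord0, (fun x => a ord_max * x); split=> [*|x]; first exact: linear_lmul.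
  apply/funext=> j; have lt_j := ltn_ord j.
  rewrite /last_face /= !inord_eqE; try lia.
  by rewrite -!val_eqE /= l0; do ?(case: eqVneq => ? //; try lia).
have [ln | lt_ln] := eqVneq (l : nat) n.+1.
  exists ord0, (fun x => x * a ord0); split=> [*|x]; first exact: linear_rmul.
  apply/funext=> j; have lt_j := ltn_ord j.
  rewrite /last_face /= !inord_eqE; try lia.
  by rewrite -!val_eqE /= ln; do ?(case: eqVneq => ? //; try lia).
exists (inord l), id; split=> // x; apply/funext=> j; have lt_j := ltn_ord j.
rewrite /last_face /= !inord_eqE ?[j == inord _]eq_sym ?inord_eqE; try lia.
by rewrite -!val_eqE /=; do ?(case: eqVneq => ? //; try lia).
Qed.

Lemma modn_lt2 x m : (x < m.*2)%N -> (x %% m)%N = if (x < m)%N then x else (x - m)%N.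
Proof.
move=> xm; case: ltnP => [/modn_small //|mx].
by rewrite -{1}(subnK mx) modnDr modn_small //; lia.
Qed.

Lemma slotwise_rot_one n i : (i < n.+1)%N -> slotwise (@rot_one n i).
Proof.
move=> lt_i a l; have lt_l := ltn_ord l.
exists (inord (if (i <= l)%N then (l - i).+1 else (l + n.+1 - i).+1)), id.
split=> // x; apply/funext=> j; have lt_j := ltn_ord j.
rewrite /rot_one /= inord_eqE; last by rewrite -ltnS ltn_pmod.
rewrite modn_lt2; last by lia.
rewrite [j == inord _]eq_sym inord_eqE; last by case: ifP; lia.
by case: (leqP i l) => il; case: ltnP => ij; do ?[case: eqVneq => ? //]; lia.
Qed.

Lemma slotwise_rot_one2 n i : (i < n.+1)%N -> slotwise (@rot_one2 n i).
Proof.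
move=> lt_i a l; have lt_l := ltn_ord l.
exists (inord (if l == i :> nat then 0%N else
               if (i <= l)%N then (l - i).+1 else (l + n.+1 - i).+1)), id.
split=> // x; apply/funext=> j; have lt_j := ltn_ord j.
rewrite /rot_one2 /= !inord_eqE; try by rewrite -ltnS ?ltn_pmod.
rewrite modn_lt2; last by lia.
rewrite [j == inord _]eq_sym inord_eqE; last by do ?case: ifP; lia.
by case: (leqP i l) => il; case: (eqVneq (l : nat) i) => li; case: ltnP => ij; do ?[case: eqVneq => ? //]; lia.
Qed.

Lemma slotwise_mul_head n c : slotwise (@mul_head n c).
Proof.
move=> a l; exists l, (fun x => if l == 0%N :> nat then x * c else x).
split=> [s x y|x]; first by case: ifP => // _; apply: linear_rmul.
apply/funext=> j; rewrite /mul_head /=.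
by case: (eqVneq j l) => [->|_] //; case: ifP.
Qed.

Lemma multilinearD p (f g : ('I_p -> A) -> k^o) :
  multilinear f -> multilinear g -> multilinear (fun a => f a + g a).
Proof. by move=> mf mg a i s x y; rewrite mf mg scalerDr addrACA. Qed.

Lemma multilinearZ p (f : ('I_p -> A) -> k^o) (t : k) :
  multilinear f -> multilinear (fun a => t *: f a).
Proof.
by move=> mf a i s x y; rewrite mf scalerDr [in LHS]scalerA mulrC -scalerA.
Qed.

Lemma multilinear_sum p m (F : 'I_m -> ('I_p -> A) -> k^o) :
  (forall i, multilinear (F i)) -> multilinear (fun a => \sum_(i < m) F i a).
Proof.
move=> mF a i s x y; rewrite scaler_sumr -big_split.
by apply: eq_bigr => j _; apply: mF.
Qed.

(* b^* and B^*, evaluated at a_0 (x) ... (x) a_n *)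
Definition bdual_fun n (f : cochain n) (a : 'I_n.+2 -> A) : k^o :=
  \sum_(i < n.+1) (-1) ^+ i *: f (face i a) + (-1) ^+ n.+1 *: f (last_face a).

Definition Bdual_fun n (f : cochain n.+1) (a : 'I_n.+1 -> A) : k^o :=
  \sum_(i < n.+1) (-1) ^+ (n * i) *: (f (rot_one i a) + f (rot_one2 i a)).

Lemma bdual_multilinear n (f : cochain n) : multilinear (bdual_fun f).
Proof.
have mf := cochain_multilinear f.
apply: multilinearD; last first.
  exact/multilinearZ/(slotwise_multilinear (@slotwise_last_face n) mf).
apply: multilinear_sum => i; apply: multilinearZ.
exact: (slotwise_multilinear (slotwise_face (ltn_ord i)) mf).
Qed.

Lemma Bdual_multilinear n (f : cochain n.+1) : multilinear (Bdual_fun f).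
Proof.
have mf := cochain_multilinear f.
apply: multilinear_sum => i; apply: multilinearZ; apply: multilinearD.
  exact: (slotwise_multilinear (slotwise_rot_one (ltn_ord i)) mf).
exact: (slotwise_multilinear (slotwise_rot_one2 (ltn_ord i)) mf).
Qed.

Definition bdual n (f : cochain n) : cochain n.+1 :=
  mk_cochain (bdual_multilinear f).
Definition Bdual n (f : cochain n.+1) : cochain n :=
  mk_cochain (Bdual_multilinear f).

Lemma bdualE n (f : cochain n) a : bdual f a =
  \sum_(i < n.+1) (-1) ^+ i *: f (face i a) + (-1) ^+ n.+1 *: f (last_face a).
Proof. by []. Qed.

Lemma BdualE n (f : cochain n.+1) a : Bdual f a =
  \sum_(i < n.+1) (-1) ^+ (n * i) *: (f (rot_one i a) + f (rot_one2 i a)).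
Proof. by []. Qed.

Lemma cochainDZE n (s : k) (f g : cochain n) a :
  (s *: f + g) a = s *: f a + g a.
Proof. by []. Qed.

Fact bdual_linear n : linear (@bdual n).
Proof.
move=> s f g; apply: cochainP => a; rewrite cochainDZE !bdualE.
rewrite cochainDZE !scalerDr scaler_sumr [RHS]addrACA -big_split.
congr (_ + _); last by rewrite !scalerA mulrC.
apply: eq_bigr => i _; rewrite cochainDZE scalerDr /= !scalerA.
by rewrite mulrC.
Qed.
HB.instance Definition _ n := GRing.isSemilinear.Build k (cochain n)
  (cochain n.+1) _ (@bdual n) (GRing.semilinear_linear (@bdual_linear n)).

Fact Bdual_linear n : linear (@Bdual n).
Proof.
move=> s f g; apply: cochainP => a; rewrite cochainDZE !BdualE.
rewrite scaler_sumr -big_split.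
apply: eq_bigr => i _; rewrite !cochainDZE.
by rewrite [in LHS]addrACA -scalerDr [LHS]scalerDr [in LHS]scalerA mulrC -scalerA.
Qed.
HB.instance Definition _ n := GRing.isSemilinear.Build k (cochain n.+1)
  (cochain n) _ (@Bdual n) (GRing.semilinear_linear (@Bdual_linear n)).

(* H^n(C_*(A)^* ) *)
Definition hochschild_cohomology n : zmodType :=
  cohomology (fun n => bdual (n := n) : {linear cochain n -> cochain n.+1}) n.

(* Degree n of the total complex of the cyclic cochain bicomplex: the sum     *)
(* over j of the cochains of degree n - 2j, nested as                         *)
(* (f_0, (f_1, (f_2, ...))).                                                  *)
Fixpoint cyc_cochain (n : nat) : lmodType k :=
  match n with
  | 0 => cochain 0
  | 1 => cochain 1
  | (m.+1 as p).+1 => (cochain p.+1 * cyc_cochain m)%type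
  end.

Definition cyc_inj n : cochain n -> cyc_cochain n :=
  match n with
  | 0 => fun f => f
  | 1 => fun f => f
  | m.+2 => fun f => (f, 0)
  end.

Definition cyc_proj n : cyc_cochain n -> cochain n :=
  match n with
  | 0 => fun f => f
  | 1 => fun f => f
  | m.+2 => fun u => u.1
  end.

(* (f_0, f_1, f_2, ...) |-> (b^* f_0, B^* f_0 + b^* f_1, B^* f_1 + b^* f_2, ...) *)
Fixpoint cyc_diff (n : nat) : cyc_cochain n -> cyc_cochain n.+1 :=
  match n with
  | 0 => fun f => bdual f
  | 1 => fun f => (bdual f, Bdual f)
  | (m.+1 as p).+1 => fun u =>
      (bdual u.1, cyc_inj (Bdual u.1) + cyc_diff u.2)
  end.

Fact cyc_inj_linear n : linear (@cyc_inj n).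
Proof.
case: n => [|[|n]] s f g //=.
by congr pair; rewrite /= scaler0 addr0.
Qed.
HB.instance Definition _ n := GRing.isSemilinear.Build k (cochain n)
  (cyc_cochain n) _ (@cyc_inj n) (GRing.semilinear_linear (@cyc_inj_linear n)).

Fact cyc_proj_linear n : linear (@cyc_proj n).
Proof. by case: n => [|[|n]]. Qed.
HB.instance Definition _ n := GRing.isSemilinear.Build k (cyc_cochain n)
  (cochain n) _ (@cyc_proj n) (GRing.semilinear_linear (@cyc_proj_linear n)).

Fact cyc_diff_linear n : linear (@cyc_diff n).
Proof.
suff: linear (@cyc_diff n) /\ linear (@cyc_diff n.+1) by case.
elim: n => [|n [IHn IHn1]].
  split=> s f g; rewrite /cyc_diff; first exact: linearP.
  by congr pair; rewrite /= linearP.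
split=> // s u v; congr pair; first exact: (linearP (@bdual n.+2)).
rewrite -[LHS]/(cyc_inj (Bdual (s *: u.1 + v.1)) + cyc_diff (s *: u.2 + v.2)).
rewrite IHn (linearP (@Bdual n.+1)) (linearP (@cyc_inj n.+1)).
by rewrite [LHS]addrACA -scalerDr.
Qed.
HB.instance Definition _ n := GRing.isSemilinear.Build k (cyc_cochain n)
  (cyc_cochain n.+1) _ (@cyc_diff n)
  (GRing.semilinear_linear (@cyc_diff_linear n)).

(* HC^n(A) *)
Definition cyclic_cohomology n : zmodType :=
  cohomology (fun n => @cyc_diff n : {linear _ -> _}) n.

Lemma cyc_proj_diff n (u : cyc_cochain n) :
  bdual (cyc_proj u) = cyc_proj (cyc_diff u).
Proof. by case: n u => [|[|n]]. Qed.

Lemma cyc_proj_cocycle n (z : cyc_cochain n) :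
  cyc_diff z = 0 -> bdual (cyc_proj z) = 0.
Proof. by move=> dz; rewrite cyc_proj_diff dz linear0. Qed.

Lemma cyc_diff1E (eta : cochain 1) : cyc_diff (n := 1) eta = (bdual eta, Bdual eta).
Proof. by []. Qed.

Lemma cyc_diff2E (beta : cochain 2) (gamma : cochain 0) :
  cyc_diff (n := 2) (beta, gamma) = (bdual beta, Bdual beta + bdual gamma).
Proof. by []. Qed.

(* I^n : HC^n(A) -> H^n(C_*(A)^* ), computed on a representative; see         *)
(* [connes_I_class] for independence of the choice.                           *)
Definition connes_I n (x : cyclic_cohomology n) : hochschild_cohomology n :=
  cohomology_class (cyc_proj_cocycle (cocycle_eq0 (repr x))).

Lemma cyc_proj_coboundary n (z : cyc_cochain n) :
  is_coboundary (fun n => @cyc_diff n : {linear _ -> _}) z ->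
  is_coboundary (fun n => bdual (n := n) : {linear cochain n -> cochain n.+1})
    (cyc_proj z).
Proof.
case: n z => [|n] z /=; first by [].
by case=> y ->; exists (cyc_proj y); exact/esym/(@cyc_proj_diff n).
Qed.

Lemma connes_I_class n (z : cyc_cochain n) (dz : cyc_diff z = 0) :
  connes_I (cohomology_class dz) = cohomology_class (cyc_proj_cocycle dz).
Proof.
apply/eqP/cohomology_classP => /=.
rewrite -[X in is_coboundary _ (X)]linearB.
apply: cyc_proj_coboundary.
rewrite -[z in X in is_coboundary _ X]/(cocycle_val (Cocycle (introT eqP dz))).
by apply/cohomology_classP; rewrite reprK.
Qed.

(* The adjoint of alpha: a (x) b (x) c |-> alpha (b (x) c) (a). *)
Section Adjoint.
Variable alpha : {bilinear A -> A -> 'Hom(A, k^o)}.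

Definition adjoint_fun (a : 'I_3 -> A) : k^o :=
  alpha (a (inord 1)) (a (inord 2)) (a (inord 0)).

Fact adjoint_multilinear : multilinear adjoint_fun.
Proof.
move=> a i s x y; rewrite /adjoint_fun /= !inord_eqE //.
case: i => -[|[|[|//]]] /= _.
- by rewrite linearP.
- by rewrite linearPl add_lfunE scale_lfunE.
- by rewrite linearPr add_lfunE scale_lfunE.
Qed.

Definition adjoint : cochain 2 := mk_cochain adjoint_multilinear.

Lemma adjointE a : adjoint a = alpha (a (inord 1)) (a (inord 2)) (a (inord 0)).
Proof. by []. Qed.

Hypothesis alphaP : hochschild_2cocycle alpha.

Lemma bdual_adjoint : bdual adjoint = 0.
Proof.
apply: cochainP => a; rewrite bdualE !big_ord_recl big_ord0 addr0 !adjointE.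
rewrite /face /last_face /=.
rewrite !inordK //=.
have -> : ord_max = inord 3 :> 'I_4 by apply: val_inj; rewrite /= inordK.
have -> : ord0 = inord 0 :> 'I_4 by apply: val_inj; rewrite /= inordK.
rewrite -[RHS](cocycleE alphaP (a (inord 1)) (a (inord 2)) (a (inord 3))
  (a (inord 0))).
by rewrite /bump /= !exprS expr0 !(mulN1r, mulr1, opprK) !scaleN1r !scale1r
  !addrA.
Qed.
End Adjoint.

(* i_c^* *)
Section Contraction.
Variable c : A.

Fact contraction_multilinear n (f : cochain n) :
  multilinear (f \o @mul_head n c).
Proof.
exact: slotwise_multilinear (@slotwise_mul_head n c) (cochain_multilinear f).
Qed.

Definition contraction n (f : cochain n) : cochain n :=
  mk_cochain (contraction_multilinear f).

Lemma contractionE n (f : cochain n) a : contraction f a = f (mul_head c a).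
Proof. by []. Qed.

Lemma bdual_contraction n (f : cochain n) :
  c \in 'Z({:A})%VS -> bdual (contraction f) = contraction (bdual f).
Proof.
rewrite memv_cap => /andP[_ /centvP cC].
have {}cC x : c * x = x * c by rewrite cC ?memvf.
apply: cochainP => a; rewrite contractionE !bdualE; congr (_ + _).
  apply: eq_bigr => i _; rewrite contractionE; congr (_ *: f _).
  apply/funext=> j; rewrite /mul_head /face.
  have lt_j := ltn_ord j; rewrite !inordK; try lia.
  case: (eqVneq (j : nat) 0%N) => j0; case: ltngtP => // ji; try lia.
  - by rewrite -!mulrA cC.
rewrite contractionE; congr (_ *: f _); apply/funext=> j.
have lt_j := ltn_ord j; rewrite /mul_head /last_face /= !inordK; try lia.
by case: eqVneq => //; rewrite mulrA.
Qed.
End Contraction.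

Section ContractionClass.
Variables (alpha : {bilinear A -> A -> 'Hom(A, k^o)})
          (alphaP : hochschild_2cocycle alpha)
          (c : A) (cZ : c \in 'Z({:A})%VS).

Lemma bdual_contraction_adjoint : bdual (contraction c (adjoint alpha)) = 0.
Proof.
by rewrite bdual_contraction // bdual_adjoint //; apply: cochainP.
Qed.

(* [i_c^*(alpha~)] *)
Definition contraction_class : hochschild_cohomology 2 :=
  cohomology_class bdual_contraction_adjoint.

End ContractionClass.

End MultilinearForms.

(* Main.v *)
Require Import Defs.
From HB Require Import structures.
From mathcomp Require Import all_boot all_algebra all_field.
From mathcomp Require Import generic_quotient.
From mathcomp Require Import boolp.
From mathcomp Require Import ring.

Set Implicit Arguments.
Unset Strict Implicit.
Unset Printing Implicit Defensive.

Import GRing.Theory.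
Local Open Scope ring_scope.

(** Write T for the extension T(A, alpha). A symmetric structure on T is the
same thing as a nondegenerate trace form on T: an isomorphism phi from T to its
dual is determined by phi 1, and left and right equivariance together say that
phi 1 is symmetric ([form_of_symmetric], [symmetric_of_form]).

Since A is finite dimensional, it is its own bidual, so every linear form on T
is (a, f) |-> h a + f c for some c in A and h in the dual of A
([hext_form_surj]). On a product the value of this form is
[h (a b) + g (c a) + f (b c) + alpha a b c], and comparing with the product in
the other order separates the conditions: the terms in f and g say that c is
central, the remaining terms are the identity of stmt2. The form is nondegenerate
exactly when c is invertible, because it takes the value g (a c) on the product
of (0, g) and (a, f). This proves that stmt1 and stmt2 are equivalent
([symmetric_hextP]).

For the equivalence with stmt3, a lift of a class [beta] of degree 2 to cyclic
cohomology may be modified by the coboundary of eta, that is by (b eta, B eta),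
so that its first component is beta itself. Hence [beta] lifts if and only if
B beta is the negative of b gamma for some gamma ([connes_I2_imageP]). For
beta the contraction of the adjoint of alpha, [B beta] evaluated at (x, y)
contains, besides [alpha x y c - alpha y x c], two terms with an argument 1 of
alpha, because alpha need not be normalized. The cocycle identity turns these
into the value of the linear form [alpha 1 1 (_ c)] at yx - xy
([Bdual_contraction_adjoint]), which is again of the form b gamma. So the
condition on gamma is the condition of stmt2 on h, with
h = gamma - alpha 1 1 (_ c) ([trace_condition_lift]). *)

(** * Finite dimensional duality *)

Section DualSpace.
Variables (k : fieldType) (V : vectType k).

Let e := vbasis {:V}.

Definition dual_coord (i : 'I_(\dim {:V})) : 'Hom(V, k^o) :=
  linfun (coord e i : V -> k^o).

Lemma dual_coordE i x : dual_coord i x = coord e i x.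
Proof. by rewrite lfunE. Qed.

Lemma dual_separates (x y : V) : (forall f : 'Hom(V, k^o), f x = f y) -> x = y.
Proof.
move=> xy; rewrite (coord_vbasis (memvf x)) (coord_vbasis (memvf y)).
by apply: eq_bigr => i _; rewrite -!dual_coordE xy.
Qed.

Lemma dual_expand (f : 'Hom(V, k^o)) :
  f = \sum_(i < \dim {:V}) f e`_i *: dual_coord i.
Proof.
apply/lfunP=> x; rewrite sum_lfunE {1}(coord_vbasis (memvf x)) linear_sum.
apply: eq_bigr => i _; rewrite linearZ scale_lfunE dual_coordE; exact: mulrC.
Qed.

Lemma bidual_eval (L : 'Hom('Hom(V, k^o), k^o)) :
  exists c : V, forall f, L f = f c.
Proof.
exists (\sum_(i < \dim {:V}) L (dual_coord i) *: e`_i) => f.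
rewrite {1}[f]dual_expand !linear_sum; apply: eq_bigr => i _.
by rewrite !linearZ; apply: mulrC.
Qed.

Lemma dim_dual : dim 'Hom(V, k^o) = dim V.
Proof. by rewrite /dim /= muln1. Qed.

End DualSpace.

(** * Symmetric algebras and trace forms *)

Section TraceForm.
Variables (k : fieldType) (T : falgType k).

(** The form is phi 1. Equivariance on one side gives phi x y = lam (y x), on
the other side phi x y = lam (x y). Nondegeneracy is stated as surjectivity of
phi, which is convenient for producing an inverse of c below. *)
Lemma form_of_symmetric : symmetric_algebra T ->
  exists lam : 'Hom(T, k^o), (forall x y, lam (x * y) = lam (y * x))
    /\ (forall mu : 'Hom(T, k^o), exists x, forall y, mu y = lam (y * x)).
Proof.
case=> phi [[psi phiK psiK] phil phir].
have lE x y : phi x y = phi 1 (y * x) by rewrite -[x in LHS]mulr1 phil lactE.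
have rE x y : phi x y = phi 1 (x * y) by rewrite -[x in LHS]mul1r phir ractE.
exists (phi 1); split=> [x y|mu]; first by rewrite -lE -rE.
by exists (psi mu) => y; rewrite -lE psiK.
Qed.

(** The map x |-> lam (_ x) is left equivariant by associativity and right
equivariant because lam is a trace; it is injective by hypothesis, hence
bijective since both sides have the same dimension. *)
Lemma symmetric_of_form (lam : 'Hom(T, k^o)) :
    (forall x y, lam (x * y) = lam (y * x)) ->
    (forall x, (forall y, lam (y * x) = 0) -> x = 0) ->
  symmetric_algebra T.
Proof.
move=> tr nondeg.
have lin : linear (fun x => lact x lam).
  move=> s x y; apply/lfunP=> z; rewrite !(add_lfunE, scale_lfunE, lactE).
  by rewrite linear_lmul linearP.
pose phi0 : {linear T -> 'Hom(T, k^o)} := HB.pack (fun x => lact x lam)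
  (GRing.isSemilinear.Build k T _ _ _ (GRing.semilinear_linear lin)).
pose phi := linfun phi0.
have phiE x y : phi x y = lam (y * x) by rewrite lfunE /= lactE.
have kphi : lker phi == 0%VS.
  apply/lker0P=> x y xy; apply/eqP; rewrite -subr_eq0; apply/eqP/nondeg => z.
  have xy0 : phi (x - y) = 0.
    by rewrite linearB; apply/eqP; rewrite subr_eq0; apply/eqP.
  by rewrite -phiE xy0 zero_lfunE.
have iphi : limg phi = fullv.
  apply/eqP; rewrite eqEdim subvf limg_dim_eq ?(eqP kphi) ?capv0 //.
  by rewrite !dimvf [X in (X <= _)%N]dim_dual leqnn.
exists phi; split=> [|a x|x a].
- exists (phi^-1%VF); first exact: lker0_lfunK.
  by move=> u; rewrite limg_lfunVK // iphi memvf.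
- by apply/lfunP=> y; rewrite lactE !phiE mulrA.
- by apply/lfunP=> y; rewrite ractE !phiE mulrA tr mulrA.
Qed.

End TraceForm.

(** * Linear forms on the Hochschild extension *)

Lemma center_comm (k : fieldType) (A : falgType k) (c : A) :
  reflect (forall x, c * x = x * c) (c \in 'Z({:A})%VS).
Proof.
rewrite memv_cap memvf /=; apply: (iffP centvP) => [cC x|cC x _].
  by rewrite cC ?memvf.
by rewrite cC.
Qed.

Section ExtensionForm.
Variables (k : fieldType) (A : falgType k).
Variables (alpha : {bilinear A -> A -> 'Hom(A, k^o)})
          (alphaP : hochschild_2cocycle alpha).
Local Notation T := (hext alphaP).

Definition hext_form_fun (c : A) (h : 'Hom(A, k^o)) (u : T) : k^o :=
  h u.1 + u.2 c.

Fact hext_form_linear c h : linear (hext_form_fun c h).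
Proof.
move=> s u v; rewrite /hext_form_fun /= linearP add_lfunE scale_lfunE.
by rewrite scalerDr [RHS]addrACA.
Qed.
HB.instance Definition _ c h := GRing.isSemilinear.Build k T k^o _
  (hext_form_fun c h) (GRing.semilinear_linear (hext_form_linear c h)).

Definition hext_form c h : 'Hom(T, k^o) := linfun (hext_form_fun c h).

Lemma hext_formE c h (a : A) (f : 'Hom(A, k^o)) :
  hext_form c h ((a, f) : T) = h a + f c.
Proof. by rewrite lfunE. Qed.

Lemma hext_form_mul c h (a b : A) (f g : 'Hom(A, k^o)) :
  hext_form c h (((a, f) : T) * (b, g)) =
    h (a * b) + g (c * a) + f (b * c) + alpha a b c.
Proof. by rewrite hext_mulE hext_formE !(add_lfunE, lactE, ractE) !addrA. Qed.

Lemma hext_form_mul0l c h (b : A) (f g : 'Hom(A, k^o)) :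
  hext_form c h (((0, f) : T) * (b, g)) = f (b * c).
Proof.
rewrite hext_form_mul mul0r mulr0 linear0l zero_lfunE !linear0.
by rewrite !add0r addr0.
Qed.

Lemma hext_form_mul0r c h (a : A) (f g : 'Hom(A, k^o)) :
  hext_form c h (((a, f) : T) * (0, g)) = g (c * a).
Proof.
rewrite hext_form_mul mul0r mulr0 linear0r zero_lfunE !linear0.
by rewrite !addr0 add0r.
Qed.

(** The restriction of lam to the dual of A is a point of the bidual, hence
evaluation at some c. *)
Lemma hext_form_surj (lam : 'Hom(T, k^o)) : exists c h, lam = hext_form c h.
Proof.
pose l1 (a : A) : k^o := lam ((a, 0) : T).
pose l2 (f : 'Hom(A, k^o)) : k^o := lam ((0, f) : T).
have lin1 : linear l1.
  move=> s x y; rewrite /l1 -linearP; congr (lam _).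
  by congr pair; rewrite /= scaler0 addr0.
have lin2 : linear l2.
  move=> s x y; rewrite /l2 -linearP; congr (lam _).
  by congr pair; rewrite /= scaler0 addr0.
pose L1 : {linear A -> k^o} := HB.pack l1
  (GRing.isSemilinear.Build k A _ _ _ (GRing.semilinear_linear lin1)).
pose L2 : {linear 'Hom(A, k^o) -> k^o} := HB.pack l2
  (GRing.isSemilinear.Build k _ _ _ _ (GRing.semilinear_linear lin2)).
have [c cE] := bidual_eval (linfun L2).
exists c, (linfun L1); apply/lfunP => -[a f].
rewrite hext_formE -cE !lfunE /= /l1 /l2 -linearD; congr (lam _).
by congr pair; rewrite /= ?addr0 ?add0r.
Qed.

Definition trace_condition c (h : 'Hom(A, k^o)) :=
  forall a b : A, alpha a b c - alpha b a c + h (a * b - b * a) = 0.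

Lemma trace_conditionE c h : trace_condition c h <->
  forall a b : A, h (a * b) + alpha a b c = h (b * a) + alpha b a c.
Proof.
have E (a b : A) : alpha a b c - alpha b a c + h (a * b - b * a)
    = h (a * b) + alpha a b c - (h (b * a) + alpha b a c).
  have -> : h (a * b - b * a) = h (a * b) - h (b * a) by apply: linearB.
  move: (h _) (h _) (alpha _ _ _) (alpha _ _ _).
  by rewrite /GRing.regular => p q r s; ring.
split=> H a b; last by rewrite E H subrr.
by apply/eqP; rewrite -subr_eq0 -E H.
Qed.

Lemma trace_of_condition c h : c \in 'Z({:A})%VS -> trace_condition c h ->
  forall u v : T, hext_form c h (u * v) = hext_form c h (v * u).
Proof.
move=> /center_comm cC /trace_conditionE H [a f] [b g].
rewrite !hext_form_mul !cC.
have := H a b.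
move: (h _) (h _) (g _) (f _) (alpha _ _ _) (alpha _ _ _).
rewrite /GRing.regular /= => p q r s t w E.
by transitivity (q + w + (r + s)); [ring | rewrite E; ring].
Qed.

(** Products of (0, f) with (b, 0) give the centrality of c, products of (a, 0)
with (b, 0) the identity for alpha. *)
Lemma condition_of_trace c h :
    (forall u v : T, hext_form c h (u * v) = hext_form c h (v * u)) ->
  c \in 'Z({:A})%VS /\ trace_condition c h.
Proof.
move=> tr; split.
  apply/center_comm => b; apply: dual_separates => f.
  by have := tr (0, f) (b, 0); rewrite hext_form_mul0l hext_form_mul0r.
apply/trace_conditionE => a b.
by have := tr (a, 0) (b, 0); rewrite !hext_form_mul !zero_lfunE !addr0.
Qed.

(** Pairing with the elements (0, g) tests a c = 0 or a c = 1, which relates the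
nondegeneracy of the form given by c and h to the invertibility of c; its
symmetry is the content of the two lemmas above. *)
Lemma symmetric_hextP :
  symmetric_algebra T <->
  exists (c : A) (h : 'Hom(A, k^o)),
    [/\ c \in 'Z({:A})%VS, c \is a GRing.unit & trace_condition c h].
Proof.
split=> [/form_of_symmetric [lam [tr surj]] | [c [h [cZ cU H]]]].
  have [c [h lamE]] := hext_form_surj lam.
  have [cZ H] : c \in 'Z({:A})%VS /\ trace_condition c h.
    by apply: condition_of_trace => u v; rewrite -lamE.
  exists c, h; split=> //.
  (* An element representing (b, g) |-> g 1 has the inverse of c as its first
     component. *)
  have [[a f] aE] := surj (hext_form 1 0).
  have /center_comm cC := cZ.
  have ca : c * a = 1.
    apply: dual_separates => g; have := aE (0, g).
    by rewrite hext_formE zero_lfunE add0r lamE hext_form_mul0l cC.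
  by apply/unitrP; exists a; rewrite -cC.
apply: (symmetric_of_form (trace_of_condition cZ H)) => -[a f] af0.
have a0 : a = 0.
  apply: (mulIr cU); rewrite mul0r; apply: dual_separates => g.
  by rewrite linear0 -(af0 (0, g)) hext_form_mul0l.
rewrite {a}a0 in af0 *; congr pair; apply/lfunP=> x; rewrite zero_lfunE.
by rewrite -(af0 (c^-1 * x, 0)) hext_form_mul0r mulVKr.
Qed.

End ExtensionForm.

(** * Lifting to cyclic cohomology *)

Section CyclicLift.
Variables (k : fieldType) (A : falgType k).

(** Explicit argument lists, on which the operators b and B of low degree can be
written out. *)
Definition args n (s : seq A) : 'I_n -> A := fun j => nth 0 s j.

Lemma args2_eta (a : 'I_2 -> A) : a = args [:: a ord0; a ord_max].
Proof. by apply/funext=> -[[|[|//]] lt_j]; congr (a _); apply: val_inj. Qed.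

Lemma bdual0_args (f : cochain A 0) x y :
  bdual f (args [:: x; y]) = f (args [:: x * y]) - f (args [:: y * x]).
Proof.
rewrite bdualE big_ord1 expr0 scale1r expr1 scaleN1r.
congr (f _ - f _); apply/funext=> -[[|//] lt_j];
  by rewrite /face /last_face /args /= ?inordK.
Qed.

Lemma bdual1_args (f : cochain A 1) x y z :
  bdual f (args [:: x; y; z]) = f (args [:: x * y; z])
    - f (args [:: x; y * z]) + f (args [:: z * x; y]).
Proof.
rewrite bdualE !big_ord_recl big_ord0 addr0 /bump /= !expr0 expr1 sqrrN expr1n.
rewrite !scale1r scaleN1r.
congr (f _ - f _ + f _); apply/funext=> -[[|[|//]] lt_j];
  by rewrite /face /last_face /args /= ?inordK.
Qed.

Lemma Bdual0_args (f : cochain A 1) x :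
  Bdual f (args [:: x]) = f (args [:: 1; x]) + f (args [:: x; 1]).
Proof.
rewrite BdualE big_ord1 expr0 scale1r.
congr (f _ + f _); apply/funext=> -[[|[|//]] lt_j];
  by rewrite /rot_one /rot_one2 /args /= ?inordK.
Qed.

Lemma Bdual1_args (f : cochain A 2) x y :
  Bdual f (args [:: x; y]) =
    f (args [:: 1; x; y]) + f (args [:: x; 1; y])
      - (f (args [:: 1; y; x]) + f (args [:: y; 1; x])).
Proof.
rewrite BdualE !big_ord_recl big_ord0 addr0 /bump /= expr0 expr1.
rewrite scale1r scaleN1r.
congr (f _ + f _ - (f _ + f _)); apply/funext=> -[[|[|[|//]]] lt_j];
  by rewrite /rot_one /rot_one2 /args /= ?inordK.
Qed.

(** The relation Bb + bB = 0 of the bicomplex, in the only degree needed to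
correct a lift by a coboundary. *)
Lemma Bdual_bdual1 (eta : cochain A 1) :
  Bdual (bdual eta) = - bdual (Bdual eta).
Proof.
apply: cochainP => a; rewrite (args2_eta a).
move: (a _) (a _) => x y.
rewrite -[RHS]/(- bdual (Bdual eta) _).
rewrite Bdual1_args bdual0_args !bdual1_args !Bdual0_args !(mul1r, mulr1).
do !move: (eta _); rewrite /GRing.regular => *; ring.
Qed.

(** If the class of beta lifts, a lift can be chosen with first component beta: if (b, g) is a
cyclic cocycle and b - beta is the coboundary of eta, then subtracting the
coboundary (b eta, B eta) from (b, g) gives such a cocycle. *)
Lemma connes_I2_imageP (beta : cochain A 2) (dbeta : bdual beta = 0) :
  (exists xi : cyclic_cohomology A 2, connes_I xi = cohomology_class dbeta)
  <-> exists gamma : cochain A 0, Bdual beta + bdual gamma = 0.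
Proof.
split=> [[xi xiE]|[gamma bg]]; last first.
  have dz : cyc_diff (n := 2) (beta, gamma) = 0.
    by rewrite cyc_diff2E dbeta bg.
  exists (cohomology_class dz); rewrite connes_I_class.
  apply/eqP/cohomology_classP; exists 0.
  by rewrite linear0; apply: subrr.
have /eqP/cohomology_classP /= := xiE.
case: (repr xi) => -[b g] dbg /= [eta etaE].
have /(congr1 snd) bg0 : cyc_diff (n := 2) (b, g) = 0.
  exact: cocycle_eq0 (Cocycle dbg).
have -> : beta = b - bdual eta by rewrite -etaE opprB addrC subrK.
exists (g - Bdual eta).
rewrite !linearB /= Bdual_bdual1 opprK addrACA subrr addr0.
exact: bg0.
Qed.

Lemma cochain0_lfun (gamma : cochain A 0) :
  exists h : 'Hom(A, k^o), forall x, gamma (args [:: x]) = h x.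
Proof.
pose g (x : A) : k^o := gamma (args [:: x]).
have argsE x : args [:: x] =
    ([eta args [:: 0 : A] with (ord0 : 'I_1) |-> x] : 'I_1 -> A).
  by apply/funext=> j; rewrite (ord1 j).
have lin : linear g.
  move=> s x y; rewrite /g (argsE (s *: x + y)) (argsE x) (argsE y).
  exact: (cochain_multilinear gamma).
pose L : {linear A -> k^o} := HB.pack g
  (GRing.isSemilinear.Build k A _ _ _ (GRing.semilinear_linear lin)).
by exists (linfun L) => x; rewrite lfunE.
Qed.

Lemma lfun_cochain0 (h : 'Hom(A, k^o)) :
  exists gamma : cochain A 0, forall x, gamma (args [:: x]) = h x.
Proof.
have mh : multilinear (fun a : 'I_1 -> A => h (a ord0) : k^o).
  by move=> a i s x y; rewrite /= (ord1 i) linearP.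
by exists (mk_cochain mh).
Qed.

Variables (alpha : {bilinear A -> A -> 'Hom(A, k^o)})
          (alphaP : hochschild_2cocycle alpha).

(** The cocycle identity at (1, 1, b). It measures how far alpha is from being
normalized. *)
Lemma cocycle_1l (b x : A) : alpha 1 b x = alpha 1 1 (b * x).
Proof.
have := cocycleE alphaP 1 1 b x; rewrite !(mul1r, mulr1) subrr add0r => /eqP.
by rewrite subr_eq0 => /eqP.
Qed.

Lemma contraction_adjoint_args c x y z :
  contraction c (adjoint alpha) (args [:: x; y; z]) = alpha y z (x * c).
Proof. by rewrite contractionE adjointE /mul_head /args /= !inordK. Qed.

Lemma Bdual_contraction_adjoint c x y : c \in 'Z({:A})%VS ->
  Bdual (contraction c (adjoint alpha)) (args [:: x; y]) =
    alpha x y c + alpha 1 1 (y * x * c)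
      - (alpha y x c + alpha 1 1 (x * y * c)).
Proof.
move=> /center_comm cC; rewrite Bdual1_args !contraction_adjoint_args !mul1r.
by rewrite (cocycle_1l y) (cocycle_1l x) !mulrA.
Qed.

(** The two linear forms h and gamma differ by t : x |-> alpha 1 1 (x c), which
absorbs the terms of B coming from a cocycle that is not normalized. *)
Lemma trace_condition_lift c : c \in 'Z({:A})%VS ->
  (exists gamma : cochain A 0,
     Bdual (contraction c (adjoint alpha)) + bdual gamma = 0)
  <-> exists h, trace_condition alpha c h.
Proof.
move=> cZ; pose t : 'Hom(A, k^o) := (alpha 1 1 \o amulr c)%VF.
have tE x : t x = alpha 1 1 (x * c) by rewrite comp_lfunE lfunE.
have sumE (gamma : cochain A 0) (h : 'Hom(A, k^o)) x y :
    (forall z, gamma (args [:: z]) = h z) ->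
    (Bdual (contraction c (adjoint alpha)) + bdual gamma) (args [:: x; y])
    = (h - t) (x * y) + alpha x y c - ((h - t) (y * x) + alpha y x c).
  move=> gh; rewrite -[LHS]/(Bdual _ _ + bdual _ _).
  rewrite Bdual_contraction_adjoint // bdual0_args !gh.
  rewrite !(add_lfunE, opp_lfunE) !tE.
  do !move: (alpha _ _ _); move: (h _) (h _); rewrite /GRing.regular => *; ring.
split=> [[gamma bg]|[h H]].
  have [h gh] := cochain0_lfun gamma.
  exists (h - t); apply/trace_conditionE => x y; apply/eqP.
  by rewrite -subr_eq0 -(sumE gamma) // bg.
have [gamma gh] := lfun_cochain0 (h + t).
exists gamma; apply: cochainP => a; rewrite (args2_eta a) (sumE _ _ _ _ gh).
by rewrite addrK; move/trace_conditionE: H => ->; apply: subrr.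
Qed.

End CyclicLift.

Theorem mainTheorem1 (k : fieldType) (A : falgType k)
    (alpha : {bilinear A -> A -> 'Hom(A, k^o)})
    (alphaP : hochschild_2cocycle alpha) :
  let stmt1 := symmetric_algebra (hext alphaP) in
  let stmt2 :=
    exists (c : A) (h : 'Hom(A, k^o)),
      [/\ c \in 'Z({:A})%VS, c \is a GRing.unit
        & forall a b : A,
            alpha a b c - alpha b a c + h (a * b - b * a) = 0] in
  let stmt3 :=
    exists (c : A) (cZ : c \in 'Z({:A})%VS),
      c \is a GRing.unit /\
      exists xi : cyclic_cohomology A 2,
        connes_I xi = contraction_class alphaP cZ in
  (stmt1 <-> stmt2) /\ (stmt2 <-> stmt3).
Proof.
move=> stmt1 stmt2 stmt3; split; first exact: symmetric_hextP.
split=> [[c [h [cZ cU H]]] | [c [cZ [cU lift]]]].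
  exists c, cZ; split=> //; apply/connes_I2_imageP/trace_condition_lift => //.
  by exists h.
have /connes_I2_imageP/(trace_condition_lift alphaP cZ) [h H] := lift.
by exists c, h.
Qed.
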